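(* Let $d\in\{2,3\}$, let $\nu\in(0,\tfrac12)$, and let $\boldsymbol f\in[\mathcal P_N]^d$. Then there exists a vector polynomial $\boldsymbol g\in[\mathcal P_{N+4}]^d$ satisfying componentwise $$\Delta^2\boldsymbol g=\frac{\boldsymbol f}{2(1-\nu)}\quad\text{in }\mathbb R^d,$$ and for any such $\boldsymbol g$ the field $$\boldsymbol u=2(1-\nu)\Delta\boldsymbol g-\nabla(\operatorname{div}\boldsymbol g)$$ belongs to $[\mathcal P_{N+2}]^d$ and solves the elastostatic system $$\Delta\boldsymbol u+\frac{1}{1-2\nu}\nabla(\operatorname{div}\boldsymbol u)=\boldsymbol f\quad\text{in }\mathbb R^d.$$
   Context: $\mathcal P_N$ denotes the space of all $d$-variate polynomials of total degree at most $N\in\mathbb N_0$. $\Delta$ acts componentwise on vector fields. $\nu$ is the Poisson's ratio. *)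

(* Defs.v *)
From HB Require Import structures.
From mathcomp Require Import all_boot all_order all_algebra.
(* The notations of [mpoly] cannot be loaded together with those of the
   analysis files; everything else, in particular its instances, can. *)
From mathcomp Require mpoly.
Import -(notations) mpoly.
From mathcomp Require Import all_classical all_reals all_analysis.
Set Implicit Arguments.
Unset Strict Implicit.
Unset Printing Implicit Defensive.
Import Order.TTheory GRing.Theory Num.Theory.
Import numFieldNormedType.Exports.
Local Open Scope ring_scope.

Section DifferentialOperators.
Variables (R : realType) (d : nat).
Implicit Types (F : 'rV[R]_d -> R) (G : 'rV[R]_d -> 'rV[R]_d).

Definition component G (i : 'I_d) : 'rV[R]_d -> R := fun x => G x ord0 i.

Definition partial (i : 'I_d) F : 'rV[R]_d -> R :=
  fun x => 'D_(delta_mx ord0 i) F x.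

Definition grad F : 'rV[R]_d -> 'rV[R]_d := fun x => \row_i partial i F x.

Definition divergence G : 'rV[R]_d -> R :=
  fun x => \sum_(i < d) partial i (component G i) x.

Definition laplacian F : 'rV[R]_d -> R :=
  fun x => \sum_(i < d) partial i (partial i F) x.

Definition vlaplacian G : 'rV[R]_d -> 'rV[R]_d :=
  fun x => \row_i laplacian (component G i) x.

(* [msize p] is one plus the total degree of [p], and 0 when [p] is 0. *)
Definition polynomial_function (N : nat) F : Prop :=
  exists2 p : mpoly.mpoly d R,
    (msize p <= N.+1)%N & forall x, F x = meval (fun i => x ord0 i) p.

Definition polynomial_field (N : nat) G : Prop :=
  forall i, polynomial_function N (component G i).

End DifferentialOperators.

(* Main.v *)
Require Import Defs.
From HB Require Import structures.
From mathcomp Require Import all_boot all_order all_algebra.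
From mathcomp Require Import all_classical all_reals all_analysis.
From mathcomp Require mpoly.
Import -(notations) mpoly.
From mathcomp Require Import ring lra zify.
Set Implicit Arguments.
Unset Strict Implicit.
Unset Printing Implicit Defensive.
Import Order.TTheory GRing.Theory Num.Theory.
Import numFieldNormedType.Exports.
Local Open Scope ring_scope.

(** The identity behind the second half is formal.  Put [c = 2 (1 - nu)].  As
    partial derivatives of polynomials commute, [u = c Delta g - grad (div g)]
    satisfies [div u = (c - 1) Delta (div g)] and
    [Delta u = c Delta^2 g - grad (Delta (div g))].  Since [c - 1 = 1 - 2 nu],
    the term [(1 - 2 nu)^-1 grad (div u)] cancels the gradient in [Delta u], and
    [c Delta^2 g = f] remains ([galerkin_identity]).

    A solution [g] exists because the Laplacian maps the polynomials of degree
    [n + 2] onto those of degree [n]; this is applied twice to each component.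
    For surjectivity it suffices to reach each monomial [X^m]
    ([poisson_solvableX]).  Single out a variable [X_0].  Then
    [Delta (X_0^2 X^m)] is a nonzero multiple of [X^m] plus monomials of the same
    total degree whose degree in the variables other than [X_0] has dropped by 2,
    so induction on that degree applies.

    Both arguments take place in the polynomial ring, with formal derivatives;
    [is_derive_polyfun] shows that the analytic directional derivative of a
    polynomial function is the function of the formal derivative, and the
    differential operators on functions then become the formal ones. *)

(** * Degree estimates *)

Section PolynomialDegree.
Variables (R : nzRingType) (d : nat).
Implicit Types (p q : mpoly d R) (i : 'I_d).

Lemma msizeD_leq p q n :
  (msize p <= n -> msize q <= n -> msize (p + q) <= n)%N.
Proof.
by move=> hp hq; apply: leq_trans (mmeasureD_le _ _ _) _; rewrite geq_max hp hq.
Qed.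

Lemma msizeB_leq p q n :
  (msize p <= n -> msize q <= n -> msize (p - q) <= n)%N.
Proof. by move=> hp hq; apply: msizeD_leq; rewrite // mmeasureN. Qed.

Lemma msize_sum_leq (I : Type) (r : seq I) (P : pred I) (F : I -> mpoly d R) n :
  (forall k, P k -> msize (F k) <= n)%N ->
  (msize (\sum_(k <- r | P k) F k) <= n)%N.
Proof.
move=> hF; elim/big_ind: _ => //; first by rewrite mmeasure0.
by move=> p q; exact: msizeD_leq.
Qed.

Lemma msize_mderiv_leq i p n :
  (msize p <= n.+1 -> msize (mderiv i p) <= n)%N.
Proof.
move=> hp; rewrite msizeE; apply/bigmax_leqP_seq => m + _.
rewrite mcoeff_msupp mcoeff_deriv => nz.
have : mnm_add m (mnm1 i) \in msupp p.
  by rewrite mcoeff_msupp; apply: contraNneq nz => ->; rewrite mul0rn.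
by move/msize_mdeg_lt; rewrite mdegD mdeg1 addn1 => /leq_trans/(_ hp).
Qed.

End PolynomialDegree.

(** * Formal differential operators *)

Section FormalOperators.
Variables (R : nzRingType) (d : nat).
Implicit Types (p : mpoly d R) (q : 'I_d -> mpoly d R) (i : 'I_d).

Definition mlap p : mpoly d R := \sum_(i < d) mderiv i (mderiv i p).

Definition mdiv q : mpoly d R := \sum_(i < d) mderiv i (q i).

Fact mlap_is_linear : linear mlap.
Proof.
move=> c p q; rewrite /mlap scaler_sumr -big_split /=.
by apply: eq_bigr => i _; rewrite !linearP.
Qed.

HB.instance Definition _ :=
  GRing.isLinear.Build R (mpoly d R) (mpoly d R) _ mlap mlap_is_linear.

Lemma mlap_mderiv i p : mlap (mderiv i p) = mderiv i (mlap p).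
Proof.
rewrite /mlap raddf_sum /=; apply: eq_bigr => j _.
by rewrite (mderiv_comm j i) (mderiv_comm j i).
Qed.

Lemma mdiv_mlap q : mdiv (fun i => mlap (q i)) = mlap (mdiv q).
Proof.
by rewrite /mdiv [RHS]raddf_sum; apply: eq_bigr => i _; rewrite -mlap_mderiv.
Qed.

Lemma msize_mlap_leq p n : (msize p <= n.+2 -> msize (mlap p) <= n)%N.
Proof.
move=> hp; apply: msize_sum_leq => i _.
by do 2!apply: msize_mderiv_leq.
Qed.

(** The divergence of [u] is [(c - 1) Delta (div q)], so that
    [k grad (div u) = grad (Delta (div q))] is what [Delta u] subtracts from
    [c Delta^2 q]. *)
Lemma galerkin_identity (c k : R) q i : k * (c - 1) = 1 ->
  let u j := c *: mlap (q j) - mderiv j (mdiv q) in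
  mlap (u i) + k *: mderiv i (mdiv u) = c *: mlap (mlap (q i)).
Proof.
move=> kc /=.
have -> : mdiv (fun j => c *: mlap (q j) - mderiv j (mdiv q))
        = (c - 1) *: mlap (mdiv q).
  rewrite scalerBl scale1r -{1}mdiv_mlap scaler_sumr -sumrB.
  by apply: eq_bigr => j _; rewrite linearB linearZ.
rewrite linearZ /= scalerA kc scale1r linearB linearZ /= mlap_mderiv.
by rewrite subrK.
Qed.
End FormalOperators.

(** * Surjectivity of the Laplacian on polynomials *)

Section SolvingPoisson.
Variables (R : numFieldType) (d : nat).
Implicit Types (p q : mpoly d R) (i : 'I_d) (m : multinom d).

(** The degree bound is part of the predicate so that it survives linear
    combinations; the gain of 2 is the order of the operator. *)
Definition poisson_solvable n p :=
  exists2 q, (msize q <= n.+2)%N & mlap q = p.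

Lemma poisson_solvableP n c p q : poisson_solvable n p ->
  poisson_solvable n q -> poisson_solvable n (c *: p + q).
Proof.
move=> [p' sp <-] [q' sq <-]; exists (c *: p' + q'); last by rewrite linearP.
by apply: msizeD_leq => //; apply: leq_trans (msizeZ_le _ _) sp.
Qed.

Lemma poisson_solvable0 n : poisson_solvable n 0.
Proof. by exists 0; rewrite ?mmeasure0 ?linear0. Qed.

Lemma mderiv2X i m :
  mderiv i (mderiv i (mpolyX R m)) =
  (m i * (m i).-1)%:R *: mpolyX R (mnm_sub (mnm_sub m (mnm1 i)) (mnm1 i)).
Proof.
by rewrite mderivX linearZ /= mderivX scalerA -natrM mnmBE mnm1E eqxx subn1.
Qed.

(** Solving [mlap q = X^m] by [q = X_i0^2 X^m / a], with
    [a = (m i0 + 2) (m i0 + 1)], leaves an error made of the second derivatives in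
    the other variables.  These are multiples of monomials of degree [mdeg m] in
    which the exponent of [X_i0] is larger by 2, hence the induction on the
    degree [mdeg m - m i0] in the other variables.  Characteristic zero is what
    makes [a] invertible. *)
Lemma poisson_solvableX (i0 : 'I_d) m :
  poisson_solvable (mdeg m).+1 (mpolyX R m).
Proof.
have [k] := ubnP (mdeg m - m i0); elim: k m => // k IHk m hk.
pose M := mnm_add (mnm_add m (mnm1 i0)) (mnm1 i0).
have Mi j : M j = (m j + 2 * (i0 == j))%N by rewrite !mnmDE mnm1E; lia.
have degM : mdeg M = (mdeg m).+2 by rewrite !mdegD !mdeg1 !addn1.
have Mi0 : M i0 = (m i0).+2 by rewrite Mi eqxx addn2.
pose a : R := (M i0 * (M i0).-1)%:R.
have a0 : a != 0 by rewrite pnatr_eq0 Mi0.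
have lapM : mlap (mpolyX R M) = a *: mpolyX R m +
    \sum_(i < d | i != i0) mderiv i (mderiv i (mpolyX R M)).
  by rewrite /mlap (bigD1 i0) //= mderiv2X /M !addmK.
have -> : mpolyX R m = a^-1 *: (mlap (mpolyX R M) -
    \sum_(i < d | i != i0) mderiv i (mderiv i (mpolyX R M))) + 0.
  by rewrite addr0 lapM addrK scalerA mulVf // scale1r.
apply: poisson_solvableP; last exact: poisson_solvable0.
rewrite addrC -scaleN1r; apply: poisson_solvableP; last first.
  by exists (mpolyX R M); rewrite // msizeX degM.
elim/big_ind: _ => [|p q sp sq|i ii0]; first exact: poisson_solvable0.
  by rewrite -[p]scale1r; apply: poisson_solvableP.
rewrite mderiv2X -[X in poisson_solvable _ X]addr0.
have Mmi : M i = m i by rewrite Mi eq_sym (negbTE ii0) muln0 addn0.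
(* The truncated subtraction in the exponent is faithful only when m i is at
   least 2; otherwise the coefficient vanishes. *)
have [mi_le1|mi_gt1] := leqP (m i) 1.
  have -> : (M i * (M i).-1 = 0)%N by rewrite Mmi; lia.
  by rewrite scale0r addr0; exact: poisson_solvable0.
apply: poisson_solvableP; last exact: poisson_solvable0.
set m' := mnm_sub _ _.
have m'E : mnm_add (mnm_add m' (mnm1 i)) (mnm1 i) = M.
  apply/mnmP => j; rewrite 2!mnmDE !mnmBE !mnm1E.
  by case: eqVneq => [<-|_]; rewrite ?Mmi; lia.
have degm' : mdeg m' = mdeg m.
  by move: degM; rewrite -m'E !mdegD !mdeg1; lia.
rewrite -degm'; apply: IHk; rewrite degm'.
have -> : m' i0 = (m i0).+2.
  by rewrite !mnmBE Mi0 !mnm1E (negbTE ii0); lia.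
have : (m i0 + m i <= mdeg m)%N.
  rewrite mdegE (bigD1 i0) //= (bigD1 i) //=; lia.
lia.
Qed.

Lemma poisson_solvable_msize (i0 : 'I_d) n p :
  (msize p <= n -> poisson_solvable n p)%N.
Proof.
move=> hp; rewrite [p]mpolyE big_seq.
elim/big_ind: _ => [|q r sq sr|m mp]; first exact: poisson_solvable0.
  by rewrite -[q]scale1r; apply: poisson_solvableP.
rewrite -[_ *: _]addr0; apply: poisson_solvableP; last exact: poisson_solvable0.
have [q sq <-] := poisson_solvableX i0 m; exists q => //.
by apply: leq_trans sq _; rewrite !ltnS; apply: leq_trans hp; exact: msize_mdeg_lt.
Qed.

End SolvingPoisson.

(** * Polynomial functions *)

Section PolynomialFunctions.
Variables (R : realType) (d : nat).
Implicit Types (p : mpoly d R) (q : 'I_d -> mpoly d R) (i : 'I_d).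

Definition polyfun p : 'rV[R]_d -> R := fun x => meval (fun i => x ord0 i) p.

Definition polyfield q : 'rV[R]_d -> 'rV[R]_d := fun x => \row_i polyfun (q i) x.

(** Coordinates are the entries of the identity map, whose derivative is known
    and computed entrywise. *)
Lemma is_derive_coord (x v : 'rV[R]_d) (j : 'I_d) :
  is_derive x v (fun y : 'rV[R]_d => y ord0 j) (v ord0 j).
Proof.
have Did := @derivable_id R 'rV[R]_d x v.
apply: DeriveDef; first exact: (derivable_mxP _ _ _).1 Did ord0 j.
have /matrixP/(_ ord0 j) := derive_mx Did.
by rewrite derive_id mxE.
Qed.

(** Both derivatives are linear, obey the product rule and agree on constants
    and on the variables, and these generate the polynomials. *)
Lemma is_derive_polyfun p (x : 'rV[R]_d) i :
  is_derive x (delta_mx ord0 i) (polyfun p) (polyfun (mderiv i p) x).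
Proof.
pose D p := is_derive x (delta_mx ord0 i) (polyfun p) (polyfun (mderiv i p) x).
have DM a b : D a -> D b -> D (a * b).
  move=> Da Db; rewrite /D mderivM.
  have -> : polyfun (a * b) = polyfun a * polyfun b.
    by apply/funext => y; rewrite /polyfun mevalM.
  apply: (is_derive_eq (is_deriveM Da Db)).
  by rewrite /polyfun mevalD !mevalM addrC mulrC.
have D1 : D 1.
  rewrite /D.
  have -> : polyfun 1 = cst 1 by apply/funext => y; rewrite /polyfun meval1.
  by apply: is_derive_eq; rewrite -mpolyC1 mderivC /polyfun meval0.
have DX j : D (mpolyX R (mnm1 j)).
  rewrite /D mderivX.
  have -> : polyfun (mpolyX R (mnm1 j)) = fun y => y ord0 j.
    by apply/funext => y; rewrite /polyfun mevalXU.
  apply: is_derive_eq; first exact: is_derive_coord.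
  rewrite !mxE eqxx mnm1E /= /polyfun mevalZ eq_sym.
  case: eqVneq => [->|_]; last by rewrite mul0r.
  by rewrite -{1}[mnm1 j]add0m addmK mpolyX0 meval1 mulr1.
rewrite -/(D p); elim/mpolyind: p => [|c m p _ _ Dp].
  rewrite /D.
  have -> : polyfun 0 = cst 0 by apply/funext => y; rewrite /polyfun meval0.
  by apply: is_derive_eq; rewrite mderiv0 /polyfun meval0.
have Dm : D (mpolyX R m).
  rewrite mpolyXE_id; elim/big_ind: _ => // j _.
  by elim: (m j) => [|k IHk]; rewrite ?expr0 ?exprS //; apply: DM.
rewrite /D linearP /=.
have -> : polyfun (c *: mpolyX R m + p)
        = c \*: polyfun (mpolyX R m) + polyfun p.
  by apply/funext => y; rewrite /polyfun mevalD mevalZ.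
apply: (is_derive_eq (is_deriveD (is_deriveZ c Dm) Dp)).
by rewrite /polyfun mevalD mevalZ.
Qed.

Lemma partial_polyfun i p : partial i (polyfun p) = polyfun (mderiv i p).
Proof.
by apply/funext => x; have := is_derive_polyfun p x i; rewrite /partial => -[].
Qed.

Lemma component_polyfield q i : component (polyfield q) i = polyfun (q i).
Proof. by apply/funext => x; rewrite /component mxE. Qed.

Lemma grad_polyfun p : grad (polyfun p) = polyfield (fun i => mderiv i p).
Proof. by apply/funext => x; apply/rowP => i; rewrite !mxE partial_polyfun. Qed.

Lemma divergence_polyfield q : divergence (polyfield q) = polyfun (mdiv q).
Proof.
apply/funext => x; rewrite /polyfun /mdiv raddf_sum; apply: eq_bigr => i _.
by rewrite component_polyfield partial_polyfun.
Qed.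

Lemma laplacian_polyfun p : laplacian (polyfun p) = polyfun (mlap p).
Proof.
apply/funext => x; rewrite /polyfun /mlap raddf_sum; apply: eq_bigr => i _.
by rewrite !partial_polyfun.
Qed.

Lemma vlaplacian_polyfield q :
  vlaplacian (polyfield q) = polyfield (fun i => mlap (q i)).
Proof.
apply/funext => x; apply/rowP => i.
by rewrite !mxE component_polyfield laplacian_polyfun.
Qed.

Lemma polynomial_fieldE N G : polynomial_field N G ->
  exists2 q, (forall i, msize (q i) <= N.+1)%N & G = polyfield q.
Proof.
move=> hG; have /choice[q hq] : forall i, exists p,
    (msize p <= N.+1)%N /\ component G i = polyfun p.
  by move=> i; have [p sp Gp] := hG i; exists p; split=> //; apply/funext.
exists q => [i|]; first by case: (hq i).
by apply/funext => x; apply/rowP => i; rewrite mxE -(hq i).2.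
Qed.

Lemma polynomial_field_polyfield N q :
  (forall i, msize (q i) <= N.+1)%N -> polynomial_field N (polyfield q).
Proof. by move=> sq i; exists (q i) => // x; rewrite component_polyfield. Qed.

End PolynomialFunctions.

(** * The elastostatic system *)

Theorem mainTheorem7 (R : realType) (d N : nat) (nu : R)
    (f : 'rV[R]_d -> 'rV[R]_d)
    (hd : d = 2%N \/ d = 3%N)
    (hnu : 0 < nu < 1 / 2)
    (hf : polynomial_field N f) :
  (exists g : 'rV[R]_d -> 'rV[R]_d,
      polynomial_field (N + 4) g /\
      forall x, vlaplacian (vlaplacian g) x = (2 * (1 - nu))^-1 *: f x) /\
  (forall g : 'rV[R]_d -> 'rV[R]_d,
      polynomial_field (N + 4) g ->
      (forall x, vlaplacian (vlaplacian g) x = (2 * (1 - nu))^-1 *: f x) ->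
      let u : 'rV[R]_d -> 'rV[R]_d :=
        fun x => (2 * (1 - nu)) *: vlaplacian g x - grad (divergence g) x in
      polynomial_field (N + 2) u /\
      forall x,
        vlaplacian u x + (1 - 2 * nu)^-1 *: grad (divergence u) x = f x).
Proof.
set c := 2 * (1 - nu).
have [nu_gt0 nu_lt] := andP hnu.
have c0 : c != 0 by apply: lt0r_neq0; rewrite /c; lra.
have k0 : 1 - 2 * nu != 0 by apply: lt0r_neq0; lra.
have kc : (1 - 2 * nu)^-1 * (c - 1) = 1.
  by rewrite (_ : c - 1 = 1 - 2 * nu) ?mulVf // /c; ring.
split=> [|g /polynomial_fieldE[q sq ->] hg u].
- have d_gt0 : (0 < d)%N by case: hd => ->.
  pose i0 := Ordinal d_gt0.
  have [p sp ->] := polynomial_fieldE hf.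
  have /choice[q hq] : forall i, exists q,
      (msize q <= N.+1.+2.+2)%N /\ mlap (mlap q) = c^-1 *: p i.
    move=> i; have [|r sr rp] := @poisson_solvable_msize _ _ i0 N.+1 (c^-1 *: p i).
      by apply: leq_trans (msizeZ_le _ _) (sp i).
    by have [q sq qr] := poisson_solvable_msize i0 sr; exists q; rewrite qr.
  exists (polyfield q); split=> [|x].
    by apply: polynomial_field_polyfield => i; have [+ _] := hq i; rewrite addnC.
  rewrite !vlaplacian_polyfield; apply/rowP => i.
  by rewrite !mxE (hq i).2 /polyfun mevalZ.
- pose w i := c *: mlap (q i) - mderiv i (mdiv q).
  have uE : u = polyfield w.
    apply/funext => x; rewrite /u divergence_polyfield grad_polyfun.
    rewrite vlaplacian_polyfield; apply/rowP => i.
    by rewrite !mxE /polyfun mevalB mevalZ.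
  rewrite uE; split=> [|x].
    apply: polynomial_field_polyfield => i; move: sq; rewrite !addnS !addn0 => sq.
    apply: msizeB_leq; last first.
      apply: msize_mderiv_leq; apply: msize_sum_leq => j _.
      exact: msize_mderiv_leq.
    by apply: leq_trans (msizeZ_le _ _) _; apply: msize_mlap_leq.
  rewrite vlaplacian_polyfield divergence_polyfield grad_polyfun.
  have -> : f x = c *: vlaplacian (vlaplacian (polyfield q)) x.
    by rewrite hg scalerA mulfV // scale1r.
  rewrite !vlaplacian_polyfield; apply/rowP => i.
  rewrite !mxE /polyfun -!mevalZ -mevalD; congr meval.
  exact: galerkin_identity.
Qed.
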